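(* The order in $\mathrm{Cones}(3)$ is the inclusion order. That is, for any two cones $C,D\subset\mathbb R^3$ with $C\subsetneq D$ one has $C<D$ in the poset $\mathrm{Cones}(3)$ (and conversely $C<D$ implies $C\subsetneq D$).
   Context: A cone in $\mathbb R^d$ means a pointed, rational, polyhedral cone, i.e. a set $C=\mathbb R_+x_1+\cdots+\mathbb R_+x_n$ with $x_1,\ldots,x_n\in\mathbb Z^d$ such that there is no nonzero $x\in C$ with $-x\in C$; the zero cone $0=\{0\}$ is included. Here $\mathbb R_+$ and $\mathbb Z_+$ denote the nonnegative reals and nonnegative integers. For $X\subset\mathbb R^d$ put $\mathsf L(X)=X\cap\mathbb Z^d$. $\mathrm{Cones}(d)$ is the set of all cones in $\mathbb R^d$, made into a poset as follows: $C<D$ if and only if there is a finite sequence of cones $C=C_0\subset C_1\subset\cdots\subset C_n=D$ in $\mathbb R^d$, with $n\ge 1$, such that for each $i=1,\ldots,n$ there is $x\in C_i\setminus C_{i-1}$ with $\mathsf L(C_i)=\mathsf L(C_{i-1})+\mathbb Z_+x$. *)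

(* Defs.v *)
From mathcomp Require Import all_boot all_order all_algebra.
From mathcomp Require Import all_classical all_reals.

Set Implicit Arguments.
Unset Strict Implicit.
Unset Printing Implicit Defensive.

Import Order.TTheory GRing.Theory Num.Theory.

Local Open Scope classical_set_scope.
Local Open Scope ring_scope.

Definition int_vec (R : realType) (d : nat) (z : 'rV[int]_d) : 'rV[R]_d :=
  map_mx intr z.

(* For n = 0 this is the zero cone. *)
Definition conic_hull (R : realType) (d n : nat) (x : 'I_n -> 'rV[int]_d) :
    set 'rV[R]_d :=
  [set v | exists a : 'I_n -> R,
     (forall i, 0 <= a i) /\ v = \sum_(i < n) a i *: int_vec R (x i)].

Definition pointed (R : realType) (d : nat) (C : set 'rV[R]_d) : Prop :=
  ~ exists x : 'rV[R]_d, [/\ x != 0, C x & C (- x)].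

Definition Cones (R : realType) (d : nat) : set (set 'rV[R]_d) :=
  [set C | (exists (n : nat) (x : 'I_n -> 'rV[int]_d), C = conic_hull x)
           /\ pointed C].

Definition lattice_pts (R : realType) (d : nat) (X : set 'rV[R]_d) :
    set 'rV[R]_d :=
  X `&` range (@int_vec R d).

(* x is not required to be integral: as 0 is in C, the last equation forces
   x itself to be a lattice point. *)
Definition elementary_ext (R : realType) (d : nat) (C D : set 'rV[R]_d) : Prop :=
  C `<=` D /\
  exists x : 'rV[R]_d, (D `\` C) x /\
    lattice_pts D =
      [set y + z | y in lattice_pts C & z in [set x *+ k | k in [set: nat]]].

(* Only the values c 0, ..., c n of the sequence matter. *)
Definition cone_lt (R : realType) (d : nat) (C D : set 'rV[R]_d) : Prop :=
  exists (n : nat) (c : nat -> set 'rV[R]_d),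
    [/\ (1 <= n)%N, c 0%N = C, c n = D,
        forall i, (i <= n)%N -> Cones (c i)
      & forall i, (i < n)%N -> elementary_ext (c i) (c i.+1)].

(* Main.v *)
Require Import Defs.
From mathcomp Require Import all_boot all_order all_algebra.
From mathcomp Require Import all_classical all_reals.
From mathcomp Require Import ring lra.

Set Implicit Arguments.
Unset Strict Implicit.
Unset Printing Implicit Defensive.

Import Order.TTheory GRing.Theory Num.Theory.

Local Open Scope classical_set_scope.
Local Open Scope ring_scope.

(** The relation [reach] is the reflexive closure of the order, without the
    pointedness requirement: the members of a chain are contained in its last
    cone, so they are pointed as soon as that one is. As the generators of [D]
    may be added to [C] one at a time, the theorem amounts to [reach_add]: if
    [D = C + R_+ v] is pointed, then [C] reaches [D].

    Suppose first that, in three-dimensional space, the only facet of [C] that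
    is visible from [v] is spanned by [w1] and [w2] ([fill_facet]). Let [G] be
    the lattice points [a w1 + b w2 + c v] with coefficients in [[0, 1)]. Taking
    integral parts of coordinates shows that every lattice point of [D] is a
    lattice point of [C + cone G] plus a multiple of [v], so the last step from
    [C + cone G] to [D] is elementary. To reach [C + cone G] from [C], wrap the
    convex hull around the ray of [w2]: its successive vertices [g] are added in
    angular order, each of them seeing the single facet spanned by the preceding
    vertex and [w2] ([fan_reach]). The facet and vector of such a step have the
    determinant [det (g, w2, g')], and this is strictly smaller than
    [det (w1, w2, v)] because the coefficients are smaller than 1. Hence one can
    argue by induction on the determinant, which is a positive integer.

    If [v] sees several facets ([reach_from_horizon]), let [w0] be an end of the
    visible part of the boundary and [w1], [w2] its next two vertices. The plane
    of [w1] and [w2] cuts the cone of [w0] and [v] in a ray; a lattice point [q]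
    of that ray sees the facet of [w0] and [w1] only, so it can be added by the
    first case. Then [w1] is no longer a vertex, [q] is the new end, and there
    are fewer visible generators. The end [w0] exists because [v] spans an
    extremal ray of [D], so that the projection of [C] along [v] is pointed
    ([horizon]).

    Finally, when [C] and [v] lie in a plane, add to both cones a vector off
    that plane. A chain of elementary extensions restricts to one on each face
    of its last cone ([reach_face]), which brings one back to [C] and [D]. *)

(** * Finite lists with a total preorder *)

Lemma preorder_min (T : eqType) (r : T -> T -> Prop) (s : seq T) :
    s != [::] -> {in s &, forall x y, r x y \/ r y x} ->
    {in s & &, forall y x z, r x y -> r y z -> r x z} ->
  exists2 x, x \in s & {in s, forall y, r x y}.
Proof.
elim: s => // x s IH _ r_tot r_trans.
have r_refl : r x x by have [] := r_tot x x (mem_head _ _) (mem_head _ _).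
have s_sub : {subset s <= x :: s} by move=> y ys; rewrite inE ys orbT.
have [s0|/IH{}IH] := eqVneq s [::].
  by exists x; rewrite ?mem_head// => y; rewrite s0 mem_seq1 => /eqP->.
have [y ys ry] := IH (sub_in2 s_sub r_tot) (sub_in3 s_sub r_trans).
have [xy|yx] := r_tot x y (mem_head _ _) (s_sub _ ys).
  exists x; first exact: mem_head.
  move=> z; rewrite inE => /predU1P[->//|zs].
  by apply: (r_trans y); rewrite ?mem_head ?s_sub//; exact: ry.
exists y; first exact: s_sub.
by move=> z; rewrite inE => /predU1P[->//|/ry].
Qed.

(** * Finitely generated cones *)

Section Cones.
Context (R : realType) (d : nat).
Implicit Types (C D S : set 'rV[R]_d) (X Y : seq 'rV[R]_d) (x y z v : 'rV[R]_d).

Definition convex_cone S :=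
  [/\ S 0, forall x y, S x -> S y -> S (x + y)
    & forall t x, 0 <= t -> S x -> S (t *: x)].

(** The conic hull, as the smallest convex cone containing the generators. *)
Definition cone X : set 'rV[R]_d :=
  [set z | forall S, convex_cone S -> {in X, forall x, S x} -> S z].

Lemma cone_convex X : convex_cone (cone X).
Proof.
split=> [S [S0 _ _] _ //|x y Xx Xy S cS XS|t x t0 Xx S cS XS].
  by have [_ SD _] := cS; apply: SD; [exact: Xx|exact: Xy].
by have [_ _ SZ] := cS; apply: SZ => //; exact: Xx.
Qed.

Lemma cone0 X : cone X 0. Proof. by have [] := cone_convex X. Qed.

Lemma coneD X x y : cone X x -> cone X y -> cone X (x + y).
Proof. by have [_ + _] := cone_convex X; apply. Qed.

Lemma coneZ X t x : 0 <= t -> cone X x -> cone X (t *: x).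
Proof. by have [_ _] := cone_convex X; apply. Qed.

Lemma cone_unscale X t x : 0 < t -> cone X (t *: x) -> cone X x.
Proof.
move=> t0 /(coneZ (t := t^-1)); rewrite invr_ge0 ltW// scalerA mulVf ?gt_eqF//.
by rewrite scale1r; exact.
Qed.

Lemma cone_gen X x : x \in X -> cone X x.
Proof. by move=> Xx S _; exact. Qed.

Lemma cone_min X S : convex_cone S -> {in X, forall x, S x} -> cone X `<=` S.
Proof. by move=> cS XS z; exact. Qed.

Lemma cone_sub X Y : {in X, forall x, cone Y x} -> cone X `<=` cone Y.
Proof. by apply: cone_min; exact: cone_convex. Qed.

Lemma cone_subset X Y : {subset X <= Y} -> cone X `<=` cone Y.
Proof. by move=> XY; apply: cone_sub => x /XY/cone_gen. Qed.

Lemma cone_eq X Y : {in X, forall x, cone Y x} -> {in Y, forall y, cone X y} ->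
  cone X = cone Y.
Proof. by move=> XY YX; apply/seteqP; split; exact: cone_sub. Qed.

Lemma cone_consl X v : cone X `<=` cone (v :: X).
Proof. by apply: cone_subset => x Xx; rewrite inE Xx orbT. Qed.

Lemma cone_head X v : cone (v :: X) v.
Proof. by apply: cone_gen; exact: mem_head. Qed.

Lemma cone_consP X v z : cone (v :: X) z ->
  exists t c, [/\ 0 <= t, cone X c & z = c + t *: v].
Proof.
move: z; apply: cone_min => [|x].
  split.
  - by exists 0, 0; rewrite scale0r addr0; split=> //; exact: cone0.
  - move=> _ _ [t [c [t0 Xc ->]]] [s [b [s0 Xb ->]]].
    exists (t + s), (c + b); rewrite scalerDl addrACA addr_ge0//.
    by split=> //; exact: coneD.
  - move=> s _ s0 [t [c [t0 Xc ->]]]; exists (s * t), (s *: c).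
    by rewrite scalerDr scalerA mulr_ge0//; split=> //; exact: coneZ.
rewrite inE => /predU1P[->|Xx].
  by exists 1, 0; rewrite scale1r add0r; split=> //; exact: cone0.
by exists 0, x; rewrite scale0r addr0; split=> //; exact: cone_gen.
Qed.

Lemma cone_cons_id X v : cone X v -> cone (v :: X) = cone X.
Proof.
move=> Xv; apply: cone_eq => x; last by move=> /cone_gen; exact: cone_consl.
by rewrite inE => /predU1P[->//|/cone_gen].
Qed.

(** * Lattice points *)

Definition integral x := [forall i, x 0 i \is a Num.int].

Lemma integralP x : reflect (forall i, x 0 i \is a Num.int) (integral x).
Proof. exact: forallP. Qed.

Lemma integralD x y : integral x -> integral y -> integral (x + y).
Proof.
by move=> /integralP ix /integralP iy; apply/integralP => i; rewrite mxE rpredD.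
Qed.

Lemma integralZ t x : t \is a Num.int -> integral x -> integral (t *: x).
Proof.
by move=> it /integralP ix; apply/integralP => i; rewrite mxE rpredM.
Qed.

Lemma integralB x y : integral x -> integral y -> integral (x - y).
Proof.
move=> /integralP ix /integralP iy; apply/integralP => i.
by rewrite !mxE rpredB.
Qed.

Lemma integralMn x n : integral x -> integral (x *+ n).
Proof. by move=> ix; rewrite -scaler_nat; apply: integralZ. Qed.

Lemma integral_int_vec (z : 'rV[int]_d) : integral (int_vec R z).
Proof. by apply/integralP => i; rewrite mxE. Qed.

Lemma range_int_vec : range (@int_vec R d) = [set x | integral x].
Proof.
apply/seteqP; split=> [_ [z _ <-]|x /= /integralP ix].
  exact: integral_int_vec.
exists (\row_i Num.floor (x 0 i)) => //.
by apply/rowP => i; rewrite !mxE floorK.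
Qed.

Lemma lattice_ptsE C : lattice_pts C = [set x | C x /\ integral x].
Proof. by rewrite /lattice_pts range_int_vec. Qed.

(** * Chains of elementary extensions *)

Definition rational_cone C := exists2 X, all integral X & C = cone X.

Lemma rational_coneI X : all integral X -> rational_cone (cone X).
Proof. by exists X. Qed.

Lemma conic_hullE n (x : 'I_n -> 'rV[int]_d) :
  conic_hull x = cone [seq int_vec R (x i) | i <- enum 'I_n].
Proof.
apply/seteqP; split=> [_ [a [a0 ->]]|].
  elim/big_ind: _ => [||i _]; [exact: cone0|exact: coneD|].
  apply: coneZ => //; apply: cone_gen; apply/mapP; exists i => //.
  by rewrite mem_enum.
apply: cone_min => [|_ /mapP[i _ ->]].
  split.
  - by exists (fun=> 0); split=> //; rewrite big1// => i _; rewrite scale0r.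
  - move=> _ _ [a [a0 ->]] [b [b0 ->]]; exists (fun i => a i + b i).
    split=> [i|]; first exact: addr_ge0.
    by rewrite -big_split; apply: eq_bigr => i _; rewrite scalerDl.
  - move=> t _ t0 [a [a0 ->]]; exists (fun i => t * a i).
    split=> [i|]; first exact: mulr_ge0.
    by rewrite scaler_sumr; apply: eq_bigr => i _; rewrite scalerA.
exists (fun j => (j == i)%:R); split=> [j|]; first exact: ler0n.
rewrite (bigD1 i)//= eqxx scale1r big1 ?addr0// => j /negPf ->.
by rewrite scale0r.
Qed.

Lemma ConesP C : Cones C <-> rational_cone C /\ pointed C.
Proof.
split=> [[[n [x ->]] pC]|[[X iX ->] pC]]; split=> //.
  exists [seq int_vec R (x i) | i <- enum 'I_n]; last exact: conic_hullE.
  by apply/allP => _ /mapP[i _ ->]; exact: integral_int_vec.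
exists (size X), (fun i => map_mx Num.floor (X`_i)).
rewrite conic_hullE; apply: congr1.
rewrite -[LHS]map_id -[in LHS](mkseq_nth 0 X) /mkseq -val_enum_ord -!map_comp.
apply: eq_map => i /=; apply/rowP => j; rewrite !mxE floorK//.
by apply/integralP: j; apply: (allP iX); exact: mem_nth.
Qed.

Inductive reach C : set 'rV[R]_d -> Prop :=
| reach_refl : reach C C
| reach_step D E : reach C D -> rational_cone E -> elementary_ext D E ->
    reach C E.

Lemma reach_trans C D E : reach C D -> reach D E -> reach C E.
Proof. by move=> CD; elim=> // D' E' _ CD'; exact: reach_step. Qed.

Lemma reach_rational C D : rational_cone C -> reach C D -> rational_cone D.
Proof. by move=> rC; case. Qed.

Lemma reach_seq C D : rational_cone C -> reach C D ->
  exists n (c : nat -> set 'rV[R]_d),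
    [/\ c 0%N = C, c n = D, forall i, (i <= n)%N -> rational_cone (c i)
      & forall i, (i < n)%N -> elementary_ext (c i) (c i.+1)].
Proof.
move=> rC; elim=> [|D' E CD' [n [c [c0 cn rc ec]]] rE eE].
  by exists 0%N, (fun=> C).
exists n.+1, (fun i => if (i <= n)%N then c i else E); split=> //.
- by rewrite ltnn.
- by move=> i _; case: ifPn => // /rc.
- move=> i; rewrite ltnS => le_in; rewrite le_in.
  by case: ltngtP le_in => // [lt_in _|-> _]; [exact: ec|rewrite cn].
Qed.

Lemma pointed_sub C D : C `<=` D -> pointed D -> pointed C.
Proof. by move=> CD pD [x [x0 /CD Dx /CD DNx]]; apply: pD; exists x. Qed.

Lemma pointed_cone X x : pointed (cone X) -> cone X x -> cone X (- x) -> x = 0.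
Proof.
by move=> pX Xx XNx; apply/eqP/negPn/negP => x0; apply: pX; exists x.
Qed.

Lemma cone_lt_reach C D : Cones C -> Cones D -> reach C D -> C <> D ->
  cone_lt C D.
Proof.
move=> /ConesP[rC _] /ConesP[_ pD] CD neqCD.
have [n [c [c0 cn rc ec]]] := reach_seq rC CD.
exists n, c; split=> //.
  by case: n cn {rc ec} => // cD; case: neqCD; rewrite -c0 -cD.
move=> i le_in; apply/ConesP; split; first exact: rc.
have cD k : (k <= n)%N -> c (n - k)%N `<=` D.
  elim: k => [|k IH] lt_kn; first by rewrite subn0 cn.
  apply: subset_trans (IH (ltnW lt_kn)).
  have [|+ _] := ec (n - k.+1)%N; last by rewrite subnSK.
  by rewrite ltn_subrL (leq_trans _ lt_kn).
apply: pointed_sub pD; have := cD (n - i)%N; rewrite subKn//; apply.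
exact: leq_subr.
Qed.

Lemma cone_lt_proper C D : cone_lt C D -> C `<` D.
Proof.
move=> [[|n] [c [//_ c0 cn _ ec]]].
have sub i : (i <= n)%N -> C `<=` c i.
  elim: i => [|i IH] le_in; first by rewrite c0.
  by apply: subset_trans (IH (ltnW le_in)) _; case: (ec i); rewrite // ltnW.
have [cnD [x [[Dx ncx] _]]] := ec n (leqnn _); rewrite -cn.
split; first by apply: subset_trans cnD; exact: sub.
by move=> /(_ x Dx)/(sub n (leqnn n)).
Qed.

(** When [v] already lies in [cone X], which can happen if it is not primitive,
    the two cones agree and no step is made. *)
Lemma reach_elementary X Y v : all integral Y -> integral v ->
    cone X `<=` cone Y -> cone Y v ->
    (forall z, cone Y z -> integral z -> exists k y,
       [/\ cone X y, integral y & z = y + v *+ k]) ->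
  reach (cone X) (cone Y).
Proof.
move=> iY iv XY Yv gen; have [Xv|nXv] := pselect (cone X v).
  suff -> : cone Y = cone X by exact: reach_refl.
  apply/seteqP; split=> //; apply: cone_sub => y Yy.
  have [||k [x [Xx _ ->]]] := gen y; [exact: cone_gen|exact: (allP iY)|].
  by apply: coneD => //; rewrite -scaler_nat; exact: coneZ.
apply: reach_step (reach_refl _) (rational_coneI iY) _; split=> //.
exists v; split=> //; rewrite !lattice_ptsE; apply/seteqP; split=> z /=.
  move=> [Yz iz]; have [k [y [Xy iy ->]]] := gen z Yz iz.
  by exists y => //; exists (v *+ k) => //; exists k.
move=> [y [Xy iy] [_ [k _ <-] <-]]; rewrite -scaler_nat; split.
  by apply: coneD; [exact: XY|exact: coneZ].
by apply: integralD => //; apply: integralZ.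
Qed.

End Cones.

Arguments integral {R d} x.

(** * Faces *)

Section Faces.
Context (R : realType) (d : nat).
Implicit Types (C D S : set 'rV[R]_d) (X Y : seq 'rV[R]_d) (x y z v : 'rV[R]_d).
Variables (l : 'rV[R]_d -> R) (l_lin : scalar l).

Let lD x y : l (x + y) = l x + l y.
Proof. by rewrite -[x]scale1r l_lin mul1r scale1r. Qed.

Let l0 : l 0 = 0.
Proof. by apply: (addrI (l 0)); rewrite -lD !addr0. Qed.

Let lZ t x : l (t *: x) = t * l x.
Proof. by rewrite -[_ *: _]addr0 l_lin l0 addr0. Qed.

(** Inequalities on a cone are always derived from those on its generators. *)
Lemma cone_halfspace X : {in X, forall x, 0 <= l x} ->
  forall z, cone X z -> 0 <= l z.
Proof.
apply: cone_min; split=> [|x y|t x]; first by rewrite l0.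
  by rewrite lD; exact: addr_ge0.
by rewrite lZ; exact: mulr_ge0.
Qed.

Lemma cone_face X : {in X, forall x, 0 <= l x} ->
  cone X `&` [set z | l z = 0] = cone [seq x <- X | l x == 0].
Proof.
move=> lX; have lX0 := cone_halfspace lX.
apply/seteqP; split=> [z [Xz lz]|z Fz]; last first.
  split.
    by move: Fz; apply: cone_subset; exact: mem_subseq (filter_subseq _ _).
  move: z Fz; apply: cone_min => [|x]; last first.
    by rewrite mem_filter => /andP[/eqP].
  split=> [//|x y /= lx ly|t x _ /= lx].
    by rewrite lD lx ly addr0.
  by rewrite lZ lx mulr0.
suff : 0 <= l z /\ (l z = 0 -> cone [seq x <- X | l x == 0] z).
  by case=> _; exact.
move: z Xz {lz}; apply: cone_min => [|x Xx].
  split=> [|x y [lx Fx] [ly Fy]|t x t0 [lx Fx]].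
  - by split=> [|_]; [rewrite l0|exact: cone0].
  - rewrite lD; split=> [|/eqP]; first exact: addr_ge0.
    by rewrite paddr_eq0// => /andP[/eqP/Fx ? /eqP/Fy ?]; exact: coneD.
  - rewrite lZ; split=> [|/eqP]; first exact: mulr_ge0.
    rewrite mulf_eq0 => /orP[/eqP->|/eqP/Fx]; last exact: coneZ.
    by rewrite scale0r; exact: cone0.
split=> [|/eqP lx]; first exact: lX.
by apply: cone_gen; rewrite mem_filter lx.
Qed.

Lemma rational_cone_face C : rational_cone C -> (forall z, C z -> 0 <= l z) ->
  rational_cone (C `&` [set z | l z = 0]).
Proof.
move=> [X iX ->] lC; rewrite cone_face => [|x /cone_gen /lC//].
apply: rational_coneI; apply/allP => x; rewrite mem_filter => /andP[_].
exact: (allP iX).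
Qed.

(** An elementary extension by [x] either happens inside the face, when [l x]
    vanishes, or leaves the lattice points of the face unchanged, hence also the
    face, which they generate. *)
Lemma reach_face C D : rational_cone C -> reach C D ->
  (forall z, D z -> 0 <= l z) ->
  reach (C `&` [set z | l z = 0]) (D `&` [set z | l z = 0]).
Proof.
move=> rC; elim=> [_|D' E CD' IH rE [D'E [x [[Ex nD'x] latE]]] lE].
  exact: reach_refl.
have {}IH := IH (fun z D'z => lE z (D'E z D'z)).
have latx : lattice_pts E = [set y + x *+ k | y in lattice_pts D' & k in setT].
  rewrite latE; apply/seteqP; split=> z.
    by move=> [y D'y [_ [k _ <-] <-]]; exists y => //; exists k.
  by move=> [y D'y [k _ <-]]; exists y => //; exists (x *+ k) => //; exists k.
have rF := rational_cone_face rE lE.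
have lMn k : l (x *+ k) = k%:R * l x by rewrite -scaler_nat lZ.
have [lx|lx] := eqVneq (l x) 0.
  apply: reach_step IH rF _; split; first exact: setSI.
  exists x; split; first by split=> // -[].
  apply/seteqP; split=> z.
    move=> [[Ez lz] iz]; have : lattice_pts E z by split.
    rewrite latx => -[y [D'y iy] [k _ zE]].
    exists y; last by exists (x *+ k) => //; exists k.
    split=> //; split=> //=; move: lz; rewrite /= -zE lD lMn lx mulr0.
    by rewrite addr0.
  move=> [y [[D'y ly] iy] [_ [k _ <-] <-]].
  have : lattice_pts E (y + x *+ k).
    by rewrite latx; exists y => //; exists k.
  by move=> [Ez iz]; split=> //; split=> //=; rewrite lD lMn lx mulr0 addr0.
suff -> : E `&` [set z | l z = 0] = D' `&` [set z | l z = 0] by [].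
apply/seteqP; split; last exact: setSI.
have [X iX EX] := rE; have [X' iX' D'X'] := reach_rational rC CD'.
have lX x' : x' \in X' -> 0 <= l x'.
  by move=> X'x'; apply: lE; apply: D'E; rewrite D'X'; exact: cone_gen.
rewrite EX D'X' !cone_face// => [|w Xw]; last first.
  by apply: lE; rewrite EX; exact: cone_gen.
apply: cone_sub => w; rewrite mem_filter => /andP[/eqP lw Xw].
rewrite -cone_face// -D'X'; split=> //.
have : lattice_pts E w.
  by rewrite lattice_ptsE EX; split; [exact: cone_gen|exact: (allP iX)].
rewrite latx => -[y [D'y _] [k _ wE]]; move: lw; rewrite -wE lD lMn => /eqP.
rewrite paddr_eq0 ?mulr_ge0// ?lE//; last exact: D'E.
by rewrite mulf_eq0 (negPf lx) orbF pnatr_eq0 => /andP[_ /eqP->]; rewrite addr0.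
Qed.

End Faces.

(** * Determinants in three-dimensional space *)

Section Space.
Context (R : realType).
Implicit Types (C D S : set 'rV[R]_3) (X Y G : seq 'rV[R]_3).
Implicit Types (x y z v w g h e : 'rV[R]_3).

Definition det3 x y z : R :=
  x 0 0 * (y 0 1 * z 0 2%:R - y 0 2%:R * z 0 1)
  - x 0 1 * (y 0 0 * z 0 2%:R - y 0 2%:R * z 0 0)
  + x 0 2%:R * (y 0 0 * z 0 1 - y 0 1 * z 0 0).

Lemma rowP3 x y : x 0 0 = y 0 0 -> x 0 1 = y 0 1 -> x 0 2%:R = y 0 2%:R ->
  x = y.
Proof.
move=> xy0 xy1 xy2; apply/rowP => i.
have [->|->|->] // : [\/ i = 0, i = 1 | i = 2%:R].
case: i => [[|[|[|]]]]// lt_i3;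
  [constructor 1|constructor 2|constructor 3]; exact: val_inj.
Qed.

Lemma cramer x a b c :
  det3 a b c *: x = det3 x b c *: a + det3 a x c *: b + det3 a b x *: c.
Proof. by apply: rowP3; rewrite /det3 !mxE; ring. Qed.

Lemma det3_linl y z : scalar (fun x => det3 x y z).
Proof. by move=> t a b; rewrite /det3 !mxE; ring. Qed.

Lemma det3_linm x z : scalar (fun y => det3 x y z).
Proof. by move=> t a b; rewrite /det3 !mxE; ring. Qed.

(** The sign turns the bounds [det3 x y z <= 0] into a half-space [0 <= l z]. *)
Lemma det3_linr x y : scalar (fun z => - det3 x y z).
Proof. by move=> t a b; rewrite /det3 !mxE; ring. Qed.

Lemma det3xxy x y : det3 x x y = 0. Proof. by rewrite /det3; ring. Qed.

Lemma det3xyx x y : det3 x y x = 0. Proof. by rewrite /det3; ring. Qed.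

Lemma det3xyy x y : det3 x y y = 0. Proof. by rewrite /det3; ring. Qed.

Lemma det3C12 x y z : det3 y x z = - det3 x y z.
Proof. by rewrite /det3; ring. Qed.

Lemma det3C13 x y z : det3 z y x = - det3 x y z.
Proof. by rewrite /det3; ring. Qed.

Lemma det3C23 x y z : det3 x z y = - det3 x y z.
Proof. by rewrite /det3; ring. Qed.

Lemma det3_int x y z : integral x -> integral y -> integral z ->
  det3 x y z \is a Num.int.
Proof.
move=> /integralP ix /integralP iy /integralP iz.
rewrite /det3; do ?[apply: rpredM|apply: rpredB|apply: rpredD];
  by [exact: ix|exact: iy|exact: iz].
Qed.

Lemma int_ler_of_ltS (t : R) m : t \is a Num.int -> t < m.+1%:R -> t <= m%:R.
Proof.
by move=> /intrP[k ->]; rewrite !pmulrn ltr_int ler_int -ltzD1 -addn1 PoszD.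
Qed.

(** * Adding a vector that sees a single facet *)

(** By Cramer's rule, the inequalities say that [C] lies in the cone spanned by
    [w1], [w2] and [- v]; hence the part of the boundary of [C] that is visible
    from [v] is the cone spanned by [w1] and [w2]. *)
Definition sees_only C w1 w2 v :=
  [/\ C w1, C w2, 0 < det3 w1 w2 v
    & forall c, C c ->
        [/\ 0 <= det3 c w2 v, 0 <= det3 w1 c v & det3 w1 w2 c <= 0]].

Lemma sees_only_gen X w1 w2 v :
    cone X w1 -> cone X w2 -> 0 < det3 w1 w2 v ->
    {in X, forall c, [/\ 0 <= det3 c w2 v, 0 <= det3 w1 c v
                       & det3 w1 w2 c <= 0]} ->
  sees_only (cone X) w1 w2 v.
Proof.
move=> Xw1 Xw2 d0 XP; split=> // c Xc; split.
- by apply: (cone_halfspace (det3_linl w2 v)) Xc => x /XP[].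
- by apply: (cone_halfspace (det3_linm w1 v)) Xc => x /XP[].
- rewrite -oppr_ge0; apply: (cone_halfspace (det3_linr w1 w2)) Xc => x /XP[].
  by rewrite oppr_ge0.
Qed.

Lemma cone3 X (a b c : R) x y z : 0 <= a -> 0 <= b -> 0 <= c ->
  cone X x -> cone X y -> cone X z -> cone X (a *: x + b *: y + c *: z).
Proof.
by move=> a0 b0 c0 Xx Xy Xz; apply: coneD; [apply: coneD|]; exact: coneZ.
Qed.

(** The statement proved by induction on the determinant, named so that the
    gift wrapping below can take it as a hypothesis. *)
Definition fillable m := forall X w1 w2 v, all integral X ->
  integral w1 -> integral w2 -> integral v ->
  sees_only (cone X) w1 w2 v -> det3 w1 w2 v <= m%:R ->
  reach (cone X) (cone (v :: X)).

(** Gift wrapping around the ray of [w], starting from the ray of [h]. The next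
    vertex [g] is chosen so that all of [G] is on one side of the plane of [h]
    and [g]. The elements of [G] that do not come after [g] in the angular order
    around [w] then lie in the cone of [h], [w] and [g], so they can be dropped;
    the others see only the facet of [g] and [w] of the enlarged cone. *)
Lemma fan_reach m : fillable m -> forall G X h w,
    all integral X -> all integral G -> integral h -> integral w ->
    {in G, forall g, sees_only (cone X) h w g} ->
    {in h :: G &, forall g g', det3 g w g' <= m%:R} ->
  reach (cone X) (cone (G ++ X)).
Proof.
move=> fm G; have [n] := ubnP (size G); elim: n G => // n IH G ltGn.
move=> X h w iX iG ih iw GP Gm.
have [->|G0] := eqVneq G [::]; first exact: reach_refl.
have Gpos g : g \in G -> 0 < det3 h w g by move=> /GP[].
have [g Gg gmin] : exists2 g, g \in G & {in G, forall g', 0 <= det3 g h g'}.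
  apply: preorder_min => // [x y _ _|y x z Gy Gx Gz xy yz].
    by rewrite (det3C13 y); rewrite oppr_ge0; case: (leP 0 (det3 y h x));
      [right|move/ltW; left].
  rewrite -(pmulr_rge0 _ (Gpos y Gy)).
  have -> : det3 h w y * det3 x h z
      = det3 h w z * det3 x h y + det3 h w x * det3 y h z.
    by rewrite /det3; ring.
  by rewrite addr_ge0// mulr_ge0// ltW// Gpos.
have ig : integral g by exact: (allP iG).
have [Xh Xw hwg_gt0 XP] := GP g Gg.
pose G' := [seq g' <- G | 0 < det3 g w g'].
have G'G : {subset G' <= G} by move=> x; rewrite mem_filter => /andP[].
have -> : cone (G ++ X) = cone (G' ++ g :: X).
  apply: cone_eq => x; last first.
    rewrite mem_cat inE => /or3P[/G'G Gx|/eqP->|Xx]; apply: cone_gen;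
      by rewrite mem_cat ?Gx ?Gg ?Xx ?orbT.
  rewrite mem_cat => /orP[Gx|Xx]; last first.
    by apply: cone_gen; rewrite mem_cat inE Xx !orbT.
  have [lt0|le0] := ltP 0 (det3 g w x).
    by apply: cone_gen; rewrite mem_cat mem_filter lt0 Gx.
  apply: (cone_subset (X := g :: X)) => [y Xy|].
    by rewrite mem_cat Xy orbT.
  apply: (cone_unscale hwg_gt0); rewrite (cramer x h w g).
  have XgX := @cone_consl _ _ X g.
  apply: cone3; [| |exact/ltW/Gpos|exact: XgX|exact: XgX|exact: cone_head].
    by rewrite det3C13 oppr_ge0.
  by rewrite det3C23 det3C12 opprK; exact: gmin.
apply: (@reach_trans _ _ _ (cone (g :: X))).
  by apply: (fm X h w g) => //; apply: Gm; rewrite inE ?eqxx ?Gg ?orbT.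
apply: (IH G' _ (g :: X) g w) => //=.
- apply: leq_trans (ltGn : size G <= n)%N.
  rewrite size_filter -(count_predC (fun x => 0 < det3 g w x) G) -addn1.
  rewrite leq_add2l -has_count; apply/hasP; exists g => //=.
  by rewrite det3xyx ltxx.
- by rewrite ig.
- by apply/allP => x /G'G; exact: (allP iG).
- move=> g' G'g'; have Gg' := G'G _ G'g'.
  have gwg' : 0 < det3 g w g' by move: G'g'; rewrite mem_filter => /andP[].
  have [_ _ hwg'_gt0 XP'] := GP g' Gg'.
  apply: sees_only_gen => //; [exact: cone_head|exact: cone_consl|].
  move=> c; rewrite inE => /predU1P[->|/cone_gen Xc].
    by rewrite (ltW gwg') det3xxy det3xyx.
  have [cwg _ _] := XP c Xc; have [cwg' hcg' hwc] := XP' c Xc.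
  split=> //; last first.
    by rewrite det3C13 oppr_le0.
  rewrite -(pmulr_rge0 _ hwg'_gt0).
  have -> : det3 h w g' * det3 g c g'
      = det3 c w g' * det3 g h g' + det3 h c g' * det3 g w g'.
    by rewrite /det3; ring.
  by apply: addr_ge0; apply: mulr_ge0 => //; [exact: gmin|exact: ltW].
- have sub x : x \in g :: G' -> x \in h :: G.
    by rewrite !inE => /predU1P[->|/G'G->]; rewrite ?Gg orbT.
  by move=> x y /sub hx /sub hy; exact: Gm.
Qed.

(** Cramer's rule shows that the coordinates of a lattice point with respect to
    [w1], [w2], [v] have the determinant as a common denominator, so the box is
    enumerated by triples of residues; the integral parts give [i], [j], [k]. *)
Lemma half_open_box w1 w2 v :
    integral w1 -> integral w2 -> integral v -> 0 < det3 w1 w2 v ->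
  exists G, [/\ all integral G,
    {in G, forall g, exists a b c : R,
      [/\ 0 <= a < 1, 0 <= b < 1, 0 <= c < 1
        & g = a *: w1 + b *: w2 + c *: v]}
    & forall z, integral z ->
        0 <= det3 z w2 v -> 0 <= det3 w1 z v -> 0 <= det3 w1 w2 z ->
        exists g i j k, g \in G /\ z = g + w1 *+ i + w2 *+ j + v *+ k].
Proof.
move=> i1 i2 iv d_gt0.
have nat_det x y z : integral x -> integral y -> integral z ->
    0 <= det3 x y z -> exists n, det3 x y z = n%:R.
  move=> ix iy iz xyz; apply/natrP.
  by rewrite -intrEge0// det3_int.
have [n dn] := nat_det _ _ _ i1 i2 iv (ltW d_gt0).
have n_gt0 : (0 < n)%N by move: d_gt0; rewrite dn ltr0n.
have nR : n%:R != 0 :> R by rewrite pnatr_eq0 -lt0n.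
pose comb (i j k : nat) : 'rV[R]_3 :=
  (i%:R / n%:R) *: w1 + (j%:R / n%:R) *: w2 + (k%:R / n%:R) *: v.
exists [seq g <- [seq comb t.1.1 t.1.2 t.2 | t : 'I_n * 'I_n * 'I_n]
           | integral g].
split; first exact: filter_all.
  move=> g; rewrite mem_filter => /andP[_ /mapP[[[i j] k] _ ->]].
  exists (i%:R / n%:R), (j%:R / n%:R), (k%:R / n%:R).
  suff bnd (l : 'I_n) : 0 <= (l%:R : R) / n%:R < 1 by split.
  by rewrite divr_ge0//= ltr_pdivrMr ?ltr0n// mul1r ltr_nat.
move=> z iz za zb zc.
have [a aE] := nat_det _ _ _ iz i2 iv za.
have [b bE] := nat_det _ _ _ i1 iz iv zb.
have [c cE] := nat_det _ _ _ i1 i2 iz zc.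
pose rem l := Ordinal (ltn_pmod l n_gt0).
exists (comb (a %% n)%N (b %% n)%N (c %% n)%N).
exists (a %/ n)%N, (b %/ n)%N, (c %/ n)%N.
have zE : z = comb (a %% n)%N (b %% n)%N (c %% n)%N
    + w1 *+ (a %/ n) + w2 *+ (b %/ n) + v *+ (c %/ n).
  have divE l : l%:R / n%:R = (l %% n)%:R / n%:R + (l %/ n)%:R :> R.
    by rewrite {1}(divn_eq l n) natrD natrM; field.
  have -> : z = comb a b c.
    apply: (scalerI (_ : det3 w1 w2 v != 0)); first by rewrite gt_eqF.
    rewrite (cramer z w1 w2 v) aE bE cE dn /comb !scalerDr !scalerA.
    by rewrite ![n%:R * _]mulrC !divfK.
  rewrite -!scaler_nat /comb (divE a) (divE b) (divE c).
  by apply: rowP3; rewrite !mxE; ring.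
split=> //; rewrite mem_filter; apply/andP; split; last first.
  by apply/mapP; exists (rem a, rem b, rem c); rewrite ?mem_enum.
have -> : comb (a %% n)%N (b %% n)%N (c %% n)%N = z - (w1 *+ (a %/ n)
    + w2 *+ (b %/ n) + v *+ (c %/ n)).
  by apply/esym/eqP; rewrite subr_eq !addrA -zE.
by rewrite integralB// !integralD ?integralMn.
Qed.

(** Only the elements of the box that lie above the plane of [w1] and [w2] have
    to be added: the others are in the facet already. *)
Lemma fill_facet m : fillable m.
Proof.
elim: m => [X w1 w2 v _ _ _ _ [_ _ d_gt0 _]|m IH X w1 w2 v iX i1 i2 iv vis dm].
  by rewrite leNgt d_gt0.
have [Xw1 Xw2 d_gt0 XP] := vis.
have [G [iG Gbox Ggen]] := half_open_box i1 i2 iv d_gt0.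
pose G' := [seq g <- G | 0 < det3 w1 w2 g].
have G'G : {subset G' <= G} by move=> x; rewrite mem_filter => /andP[].
have iG' : all integral G' by apply/allP => x /G'G; exact: (allP iG).
have lowG' : reach (cone X) (cone (G' ++ X)).
  apply: (fan_reach IH (h := w1) (w := w2)) => //.
    move=> g G'g; have g_gt0 : 0 < det3 w1 w2 g.
      by move: G'g; rewrite mem_filter => /andP[].
    split=> // x Xx; have [x1 x2 x3] := XP x Xx.
    have [a [b [c [/andP[a0 _] /andP[b0 _] /andP[c0 _] gE]]]] :=
      Gbox g (G'G _ G'g).
    split=> //.
      have -> : det3 x w2 g = a * - det3 w1 w2 x + c * det3 x w2 v.
        by rewrite gE /det3 !mxE; ring.
      by rewrite addr_ge0// mulr_ge0// oppr_ge0.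
    have -> : det3 w1 x g = b * - det3 w1 w2 x + c * det3 w1 x v.
      by rewrite gE /det3 !mxE; ring.
    by rewrite addr_ge0// mulr_ge0// oppr_ge0.
  have box g : g \in w1 :: G' -> integral g /\
      exists a b c : R,
        [/\ 0 <= a <= 1, 0 <= c < 1 & g = a *: w1 + b *: w2 + c *: v].
    rewrite inE => /predU1P[->|/G'G Gg].
      split=> //; exists 1, 0, 0.
      by rewrite scale1r !scale0r !addr0 ler01 !lexx ltr01.
    split; first exact: (allP iG).
    have [a [b [c [/andP[a0 a1] _ c01 gE]]]] := Gbox g Gg.
    by exists a, b, c; rewrite a0 ltW.
  move=> g g' /box[ig [a [b [c [/andP[a0 a1] /andP[c0 c1] gE]]]]].
  move=> /box[ig' [a' [b' [c' [/andP[a'0 a'1] /andP[c'0 c'1] gE']]]]].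
  (* The [w1] and [v] coordinates lie in [[0, 1]] and [[0, 1)], so the 2 x 2
     minor of [g], [g'] is smaller than 1. *)
  apply: int_ler_of_ltS; first exact: det3_int.
  apply: lt_le_trans dm.
  have -> : det3 g w2 g' = (a * c' - c * a') * det3 w1 w2 v.
    by rewrite gE gE' /det3 !mxE; ring.
  rewrite gtr_pMl//.
  have : a * c' <= c' by rewrite ler_piMl.
  have : 0 <= c * a' by exact: mulr_ge0.
  lra.
apply: (reach_trans lowG').
have XG'v : cone (v :: X) = cone (v :: G' ++ X).
  apply: cone_eq => x.
    rewrite inE => /predU1P[->|Xx]; apply: cone_gen;
      by rewrite ?mem_head// inE mem_cat Xx !orbT.
  rewrite inE => /predU1P[->|]; first exact: cone_head.
  rewrite mem_cat => /orP[/G'G/Gbox|Xx]; last first.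
    by apply: cone_gen; rewrite inE Xx orbT.
  move=> [a [b [c [/andP[a0 _] /andP[b0 _] /andP[c0 _] ->]]]].
  by apply: cone3 => //; [exact: cone_consl|exact: cone_consl|exact: cone_head].
rewrite XG'v; apply: (@reach_elementary _ _ _ _ v) => //.
- by rewrite /= iv all_cat iG'.
- exact: cone_consl.
- exact: cone_head.
move=> z; rewrite -XG'v => Yz iz.
have XG' : cone X `<=` cone (G' ++ X).
  by apply: cone_subset => x Xx; rewrite mem_cat Xx orbT.
have [t [x [t0 Xx zE]]] := cone_consP Yz; have [x1 x2 x3] := XP x Xx.
(* A point of [D] below the plane of [w1] and [w2] is already in [C]: it is
   between [x] and the point where the ray from [x] in the direction [v] meets
   the facet. *)
have [z_ge0|z_lt0] := leP 0 (det3 w1 w2 z); last first.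
  exists 0%N, z; rewrite mulr0n addr0; split=> //; apply: XG'.
  have dz : det3 w1 w2 z = det3 w1 w2 x + t * det3 w1 w2 v.
    by rewrite zE /det3 !mxE; ring.
  have x3_lt0 : 0 < - det3 w1 w2 x.
    rewrite oppr_gt0; apply: le_lt_trans z_lt0.
    by rewrite dz lerDl mulr_ge0// ltW.
  apply: (cone_unscale x3_lt0).
  have -> : - det3 w1 w2 x *: z = - det3 w1 w2 z *: x
      + (t * det3 x w2 v) *: w1 + (t * det3 w1 x v) *: w2.
    by rewrite zE; apply: rowP3; rewrite /det3 !mxE; ring.
  by apply: cone3 => //; rewrite ?mulr_ge0// oppr_ge0 ltW.
have [||g [i [j [k [Gg zgE]]]]] := Ggen z iz _ _ z_ge0.
- suff -> : det3 z w2 v = det3 x w2 v by [].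
  by rewrite zE /det3 !mxE; ring.
- suff -> : det3 w1 z v = det3 w1 x v by [].
  by rewrite zE /det3 !mxE; ring.
exists k, (g + w1 *+ i + w2 *+ j); split=> //; last first.
  by rewrite !integralD ?integralMn//; exact: (allP iG).
rewrite -!scaler_nat; apply: coneD; first apply: coneD; last 2 first.
- by apply: coneZ => //; exact: XG'.
- by apply: coneZ => //; exact: XG'.
have [g_gt0|g_le0] := ltP 0 (det3 w1 w2 g).
  by apply: cone_gen; rewrite mem_cat mem_filter g_gt0 Gg.
have [a [b [c [/andP[a0 _] /andP[b0 _] /andP[c0 _] gE]]]] := Gbox g Gg.
apply: XG'.
have c_eq0 : c = 0.
  apply: le_anti; rewrite c0 andbT -(pmulr_lle0 _ d_gt0).
  suff <- : det3 w1 w2 g = c * det3 w1 w2 v by [].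
  by rewrite gE /det3 !mxE; ring.
rewrite gE c_eq0 scale0r addr0.
by apply: coneD; exact: coneZ.
Qed.

End Space.

(** * Adding a vector that sees several facets *)

Section Visible.
Context (R : realType).
Implicit Types (C D : set 'rV[R]_3) (X Y : seq 'rV[R]_3).
Implicit Types (x y z u v w q e : 'rV[R]_3).

Lemma reach_facet X w1 w2 v : all integral X -> integral w1 -> integral w2 ->
  integral v -> sees_only (cone X) w1 w2 v -> reach (cone X) (cone (v :: X)).
Proof.
move=> iX i1 i2 iv vis; have [_ _ d_gt0 _] := vis.
have /natrP[m dE] : det3 w1 w2 v \is a Num.nat.
  by rewrite -intrEge0 ?det3_int// ltW.
by apply: (fill_facet iX i1 i2 iv vis (m := m)); rewrite dE.
Qed.

(** Angular order around the ray of [v]; among vectors of the same half-plane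
    bounded by the line of [v], those closer to [v] come first. *)
Definition precedes v w x := 0 < det3 w x v \/
  exists a b, [/\ 0 <= a, 0 <= b & x = a *: w - b *: v].

Lemma precedes_ge0 v w x : precedes v w x -> 0 <= det3 w x v.
Proof.
case=> [/ltW//|[a [b [_ _ ->]]]].
by rewrite le_eqVlt; apply/orP; left; apply/eqP; rewrite /det3 !mxE; ring.
Qed.

(** The facet at [w0] that is visible from [v], with [w1] its vertex farthest
    from [w0]: the generators are compared by the slope of their plane with
    [w0], and by their distance to [w0] when these planes agree. The choice of
    the farthest one gives the strict inequality in the last clause. *)
Lemma visible_facet v w0 X :
    {in X, forall x, precedes v w0 x} -> has (fun x => 0 < det3 w0 x v) X ->
  exists w1, [/\ w1 \in X, 0 < det3 w0 w1 v
    & {in X, forall x, det3 w0 w1 x <= 0 /\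
        (det3 x w1 v < 0 -> 0 < det3 w0 x v /\ det3 w0 w1 x < 0)}].
Proof.
move=> w0X hasX; pose Y := [seq x <- X | 0 < det3 w0 x v].
pose r w x := det3 w0 w x < 0 \/ det3 w0 w x = 0 /\ 0 <= det3 x w v.
have YX x : x \in Y -> x \in X /\ 0 < det3 w0 x v.
  by rewrite mem_filter => /andP[].
have [w1 Yw1 w1min] : exists2 w1, w1 \in Y & {in Y, forall x, r w1 x}.
  apply: preorder_min => [|x y _ _|y x z /YX[_ y0] /YX[_ x0] /YX[_ z0]].
  - by rewrite -has_filter.
  - have [xy|xy|xy] := ltgtP (det3 w0 x y) 0; first by left; left.
      by right; left; rewrite det3C23 oppr_lt0.
    have yx : det3 w0 y x = 0 by rewrite det3C23 xy oppr0.
    have [h|h] := leP 0 (det3 x y v); first by right; right.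
    by left; right; split=> //; rewrite det3C12 oppr_ge0 ltW.
  - have eD : det3 w0 y v * det3 w0 x z
        = det3 w0 z v * det3 w0 x y + det3 w0 x v * det3 w0 y z.
      by rewrite /det3; ring.
    have eE : det3 w0 y v * det3 z x v
        = det3 w0 z v * det3 y x v + det3 w0 x v * det3 z y v.
      by rewrite /det3; ring.
    rewrite /r -(pmulr_rlt0 (det3 w0 x z) y0) eD.
    move=> [xy|[xy exy]] [yz|[yz eyz]].
    + left; have : det3 w0 z v * det3 w0 x y < 0 by rewrite pmulr_rlt0.
      have : det3 w0 x v * det3 w0 y z < 0 by rewrite pmulr_rlt0.
      lra.
    + by left; rewrite yz mulr0 addr0 pmulr_rlt0.
    + by left; rewrite xy mulr0 add0r pmulr_rlt0.
    + right; split; last first.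
        by rewrite -(pmulr_rge0 _ y0) eE addr_ge0// mulr_ge0// ltW.
      apply: (mulfI (lt0r_neq0 y0)); rewrite eD xy yz !mulr0 addr0.
      by [].
have [Xw1 w1_gt0] := YX _ Yw1; exists w1; split=> // x Xx.
have [x_gt0|[a [b [a0 b0 ->]]]] := w0X x Xx.
  have [|xlt|[xeq xA]] := w1min x; first by rewrite mem_filter x_gt0.
    by split; [exact: ltW|].
  by rewrite xeq lexx; split=> //; rewrite ltNge xA.
have -> : det3 w0 w1 (a *: w0 - b *: v) = - (b * det3 w0 w1 v).
  by rewrite /det3 !mxE; ring.
have -> : det3 (a *: w0 - b *: v) w1 v = a * det3 w0 w1 v.
  by rewrite /det3 !mxE; ring.
rewrite oppr_le0 mulr_ge0 ?(ltW w1_gt0)//; split=> //.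
by rewrite ltNge mulr_ge0// ltW.
Qed.

Lemma cone_cons_congr X Y v : cone X = cone Y -> cone (v :: X) = cone (v :: Y).
Proof.
move=> XY; apply: cone_eq => x; rewrite inE => /predU1P[->|].
- exact: cone_head.
- by move=> /cone_gen; rewrite XY; exact: cone_consl.
- exact: cone_head.
- by move=> /cone_gen; rewrite -XY; exact: cone_consl.
Qed.

(** Induction on the number of generators strictly beyond the horizon ray
    [w0]. *)
Lemma reach_from_horizon X w0 v :
    all integral X -> integral w0 -> integral v -> cone X w0 ->
    has (fun x => 0 < det3 w0 x v) X -> {in X, forall x, precedes v w0 x} ->
  reach (cone X) (cone (v :: X)).
Proof.
have [n] := ubnP (count (fun x => 0 < det3 w0 x v) X).
elim: n X w0 => // n IH X w0 ltXn iX i0 iv Xw0 hasX w0X.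
have [w1 [Xw1 d_gt0 w1X]] := visible_facet w0X hasX.
have i1 : integral w1 by exact: (allP iX).
pose Z := [seq x <- X | det3 x w1 v < 0].
(* [Z] are the generators that prevent [v] from seeing this facet only. *)
have [Z0|Z_neq0] := eqVneq Z [::].
  apply: (reach_facet iX i0 i1 iv); apply: sees_only_gen => //.
    exact: cone_gen.
  move=> x Xx; have [x3 _] := w1X x Xx; split=> //.
    rewrite leNgt; apply/negP => xlt0.
    by have : x \in Z; [rewrite mem_filter xlt0|rewrite Z0].
  exact/precedes_ge0/w0X.
(* [w0 + t v] sees this facet only, as long as [t] is at most the quotient
   below for each [x] in [Z]. *)
have [w2 + w2min] : exists2 w2, w2 \in Z & {in Z, forall x,
    det3 w0 w1 w2 / det3 w2 w1 v <= det3 w0 w1 x / det3 x w1 v}.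
  apply: preorder_min => // [x y _ _|y x z _ _ _]; last exact: le_trans.
  by apply/orP; exact: le_total.
rewrite mem_filter => /andP[A2_lt0 Xw2].
have [_ /(_ A2_lt0)[B2_gt0 G2_lt0]] := w1X w2 Xw2.
have i2 : integral w2 by exact: (allP iX).
set A2 := det3 w2 w1 v in A2_lt0 w2min; set G2 := det3 w0 w1 w2 in G2_lt0 w2min.
have NA2 : 0 < - A2 by rewrite oppr_gt0.
have NG2 : 0 < - G2 by rewrite oppr_gt0.
pose q := (- A2) *: w0 + (- G2) *: v.
have iq : integral q by rewrite integralD// integralZ// rpredN det3_int.
have qE x : det3 q x v = - A2 * det3 w0 x v.
  by rewrite /q /det3 !mxE; ring.
have Xq : cone (v :: X) q.
  apply: coneD; apply: coneZ; rewrite ?ltW//; last exact: cone_head.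
  exact: cone_consl.
have reach_q : reach (cone X) (cone (q :: X)).
  apply: (reach_facet iX i0 i1 iq); apply: sees_only_gen => //.
  - exact: cone_gen.
  - have -> : det3 w0 w1 q = - G2 * det3 w0 w1 v.
      by rewrite /q /det3 !mxE; ring.
    exact: mulr_gt0.
  move=> x Xx; have [x3 _] := w1X x Xx; split=> //.
    have -> : det3 x w1 q = A2 * det3 w0 w1 x - G2 * det3 x w1 v.
      by rewrite /q /det3 !mxE; ring.
    rewrite subr_ge0; have [xlt0|xge0] := ltP (det3 x w1 v) 0.
      have := w2min x; rewrite mem_filter xlt0 => /(_ Xx).
      rewrite ler_ndivrMr// mulrAC ler_ndivrMr//.
      by rewrite [det3 w0 w1 x * _]mulrC.
    apply: (@le_trans _ _ 0); first by rewrite nmulr_rle0.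
    by rewrite nmulr_rge0.
  have -> : det3 w0 x q = - G2 * det3 w0 x v.
    by rewrite /q /det3 !mxE; ring.
  by rewrite pmulr_rge0// precedes_ge0//; exact: w0X.
apply: (reach_trans reach_q).
pose X1 := q :: rem w1 X.
have w2_neq_w1 : w2 != w1.
  apply: contraTneq A2_lt0 => w21.
  by rewrite /A2 w21 det3xxy ltxx.
have Xrem := perm_to_rem Xw1.
have X1w2 : w2 \in rem w1 X.
  by move: Xw2; rewrite (perm_mem Xrem) inE (negPf w2_neq_w1).
have X1X : cone (q :: X) = cone X1.
  apply: cone_eq => x; rewrite inE => /predU1P[->|Xx]; try exact: cone_head.
    move: Xx; rewrite (perm_mem Xrem) inE => /predU1P[->|Xx]; last first.
      by apply: cone_gen; rewrite inE Xx orbT.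
    apply: (cone_unscale B2_gt0).
    have -> : det3 w0 w2 v *: w1 = det3 w0 w1 v *: w2 + q.
      by rewrite /q /A2 /G2; apply: rowP3; rewrite /det3 !mxE; ring.
    apply: coneD; last exact: cone_head.
    by apply: coneZ; [exact: ltW|apply: cone_gen; rewrite inE X1w2 orbT].
  by apply: cone_gen; rewrite inE (mem_rem Xx) orbT.
have -> : cone (v :: X) = cone (v :: X1).
  rewrite -(cone_cons_congr _ X1X); apply: cone_eq => x.
    rewrite inE => /predU1P[->|Xx]; [exact: cone_head|].
    by apply: cone_gen; rewrite !inE Xx !orbT.
  rewrite !inE => /or3P[/eqP->|/eqP->//|Xx]; [exact: cone_head|].
  by apply: cone_gen; rewrite !inE Xx !orbT.
have qpos x : (0 < det3 q x v) = (0 < det3 w0 x v) by rewrite qE pmulr_rgt0.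
rewrite X1X; apply: (IH X1 q) => //.
- rewrite /= det3xxy ltxx add0n (eq_count qpos).
  rewrite count_rem Xw1 d_gt0 /= subn1 prednK //.
  by rewrite -has_count.
- by rewrite /= iq; apply/allP => x /mem_rem; exact: (allP iX).
- exact: cone_head.
- by apply/hasP; exists w2; rewrite ?inE ?X1w2 ?orbT// qpos.
move=> x; rewrite inE => /predU1P[->|/mem_rem/w0X[x_gt0|[a [b [a0 b0 ->]]]]].
- by right; exists 1, 0; rewrite scale1r scale0r subr0 !lexx ler01.
- by left; rewrite qpos.
right; exists (a / - A2), (b + a * - G2 / - A2).
have [A2_ge0 G2_ge0] := (ltW NA2, ltW NG2).
rewrite divr_ge0// addr_ge0// ?divr_ge0 ?mulr_ge0//.
by split=> //; rewrite /q; apply: rowP3; rewrite !mxE; field; rewrite lt_eqF.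
Qed.

(** * Existence of a horizon *)

Definition cross x y : 'rV[R]_3 := \row_i
  if i == 0 then x 0 1 * y 0 2%:R - x 0 2%:R * y 0 1
  else if i == 1 then x 0 2%:R * y 0 0 - x 0 0 * y 0 2%:R
  else x 0 0 * y 0 1 - x 0 1 * y 0 0.

Lemma crossE x y : (cross x y 0 0 = x 0 1 * y 0 2%:R - x 0 2%:R * y 0 1)
  * (cross x y 0 1 = x 0 2%:R * y 0 0 - x 0 0 * y 0 2%:R)
  * (cross x y 0 2%:R = x 0 0 * y 0 1 - x 0 1 * y 0 0).
Proof. by rewrite !mxE. Qed.

Lemma cross_int x y : integral x -> integral y -> integral (cross x y).
Proof.
move=> /integralP ix /integralP iy; apply/integralP => i; rewrite mxE.
by do 2?case: ifP => _; apply: rpredB; apply: rpredM.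
Qed.

(** When [x] and [y] are not parallel, their cross product is an integral vector
    off their plane, with respect to which Cramer's rule can be applied. *)
Lemma cross_eq0_or_det3_gt0 x y : cross x y = 0 \/ 0 < det3 x (cross y x) y.
Proof.
have -> : det3 x (cross y x) y =
    cross x y 0 0 ^+ 2 + cross x y 0 1 ^+ 2 + cross x y 0 2%:R ^+ 2.
  by rewrite /det3 !crossE; ring.
have [->|/eqP] := eqVneq (cross x y) 0; [by left|move=> n0; right].
rewrite lt_neqAle !addr_ge0 ?sqr_ge0// andbT eq_sym.
apply/negP; rewrite !paddr_eq0 ?addr_ge0 ?sqr_ge0// !sqrf_eq0.
move=> /andP[/andP[/eqP h0 /eqP h1] /eqP h2]; apply: n0.
by apply: rowP3; rewrite ?h0 ?h1 ?h2 mxE.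
Qed.

Lemma parallel x y : y != 0 -> cross x y = 0 -> exists t, x = t *: y.
Proof.
move=> yN0 xy0; have [c1 c2 c3] : [/\ x 0 1 * y 0 2%:R = x 0 2%:R * y 0 1,
    x 0 2%:R * y 0 0 = x 0 0 * y 0 2%:R & x 0 0 * y 0 1 = x 0 1 * y 0 0].
  by split; apply/eqP; rewrite -subr_eq0 -crossE xy0 mxE.
have [y0|y0] := eqVneq (y 0 0) 0; last first.
  exists (x 0 0 / y 0 0); apply: rowP3; rewrite mxE ?divfK//.
    by apply: (mulIf y0); rewrite mulrAC divfK.
  by apply: (mulIf y0); rewrite mulrAC divfK.
have [y1|y1] := eqVneq (y 0 1) 0; last first.
  exists (x 0 1 / y 0 1); apply: rowP3; rewrite mxE ?divfK//.
    by apply: (mulIf y1); rewrite mulrAC divfK.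
  by apply: (mulIf y1); rewrite mulrAC divfK.
have y2 : y 0 2%:R != 0.
  by apply: contraNneq yN0 => y2; apply/eqP/rowP3; rewrite mxE.
exists (x 0 2%:R / y 0 2%:R); apply: rowP3; rewrite mxE ?divfK//.
  by apply: (mulIf y2); rewrite mulrAC divfK.
by apply: (mulIf y2); rewrite mulrAC divfK.
Qed.

(** As [v] is extremal in the pointed cone [cone (v :: X)], nonzero elements of
    [cone X] have nonzero projections along [v], and these projections generate
    a pointed plane cone. So [precedes v] is a total preorder on the nonzero
    generators, and the horizon ray is its least element. *)
Lemma horizon X v : pointed (cone (v :: X)) -> ~ cone X v ->
    (exists x y, [/\ x \in X, y \in X & det3 x y v != 0]) ->
  exists w, [/\ w \in X, has (fun x => 0 < det3 w x v) X
    & {in X, forall x, precedes v w x}].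
Proof.
move=> pD nXv [x0 [y0 [Xx0 Xy0 d0]]].
have XD : cone X `<=` cone (v :: X) by exact: cone_consl.
have line0 c t : cone X c -> c = t *: v -> c = 0.
  move=> Xc cE; have [t0|t0] := ltP 0 t.
    by case: nXv; apply: (cone_unscale t0); rewrite -cE.
  apply: (pointed_cone pD); first exact: XD.
  by rewrite cE -scaleNr; apply: coneZ; [rewrite oppr_ge0|exact: cone_head].
(* The two ways in which pointedness is used: [line0] says that no nonzero
   element of [cone X] projects to 0, and [sum0] that no nonzero generator can
   be cancelled. *)
have sum0 x c a : x \in X -> cone X c -> 0 < a -> a *: x + c = 0 -> x = 0.
  move=> Xx Xc a0 /eqP; rewrite addr_eq0 => /eqP xE.
  apply: (pointed_cone pD); first by apply: XD; exact: cone_gen.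
  by apply: (cone_unscale a0); rewrite scalerN xE opprK; exact: XD.
pose s := [seq x <- X | x != 0].
have sX x : x \in s -> x \in X /\ x != 0 by rewrite mem_filter => /andP[].
have plane w x : w \in s -> x \in s -> det3 w x v = 0 ->
    exists a b, 0 < a /\ x = a *: w + b *: v.
  move=> /sX[Xw w0] /sX[Xx xN0] wxv.
  have [wv0|u_gt0] := cross_eq0_or_det3_gt0 w v.
    have vN0 : v != 0.
      by apply/eqP => v0; apply: nXv; rewrite v0; exact: cone0.
    have [t wE] := parallel vN0 wv0.
    by rewrite (line0 w t) ?eqxx// in w0; exact: cone_gen.
  set u := cross v w in u_gt0.
  pose a := det3 x u v / det3 w u v; pose b := det3 w u x / det3 w u v.
  have xE : x = a *: w + b *: v.
    apply: (scalerI (lt0r_neq0 u_gt0)).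
    rewrite (cramer x w u v) wxv scale0r addr0.
    by rewrite scalerDr !scalerA ![det3 w u v * _]mulrC !divfK// gt_eqF.
  exists a, b; split=> //; rewrite ltNge; apply/negP => a_le0.
  have Xc : cone X ((- a) *: w).
    by apply: coneZ; [rewrite oppr_ge0|exact: cone_gen].
  move/negP: xN0; apply; apply/eqP; apply: (sum0 x ((- a) *: w) 1) => //.
  apply: (line0 _ b).
    by rewrite scale1r; apply: coneD => //; exact: cone_gen.
  by rewrite scale1r {1}xE addrAC scaleNr subrr add0r.
have [w sw wmin] : exists2 w, w \in s & {in s, forall x, precedes v w x}.
  apply: preorder_min => [|x y sx sy|w y x sw sy sx].
  - rewrite -has_filter; apply/hasP; exists x0 => //.
    by apply: contraNneq d0 => ->; rewrite /det3 !mxE; apply/eqP; ring.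
  - have [d|d|d] := ltgtP (det3 x y v) 0; last 1 first.
    + have [a [b [a0 yE]]] := plane x y sx sy d.
      have [b0|b0] := leP b 0.
        left; right; exists a, (- b).
        by rewrite oppr_ge0 (ltW a0) scaleNr opprK.
      right; right; exists a^-1, (b / a).
      rewrite invr_ge0 divr_ge0 ?ltW//; split=> //.
      rewrite yE; apply: rowP3; rewrite !mxE; field; exact: lt0r_neq0.
    + by right; left; rewrite det3C12 oppr_gt0.
    + by left; left.
  have [Xx xN0] := sX x sx; have [Xy yN0] := sX y sy; have [Xw wN0] := sX w sw.
  move=> [yw|[a [b [a0 b0 wE]]]] [wx|[a' [b' [a'0 b'0 xE]]]].
  - left; rewrite ltNge; apply/negP => yx.
    have Xc : cone X ((- det3 y x v) *: w + det3 y w v *: x).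
      by apply: coneD; apply: coneZ;
        rewrite ?oppr_ge0// ?(ltW yw)//; exact: cone_gen.
    move/negP: yN0; apply; apply/eqP.
    apply: (sum0 y ((- det3 y x v) *: w + det3 y w v *: x) (det3 w x v)) => //.
    apply: (line0 _ (det3 y w x)); last first.
      by apply: rowP3; rewrite /det3 !mxE; ring.
    by apply: coneD => //; apply: coneZ; [exact: ltW|exact: cone_gen].
  - left; have [a'_eq0|a'N0] := eqVneq a' 0.
      move: xN0; rewrite (line0 x (- b')) ?eqxx//; first exact: cone_gen.
      by rewrite {1}xE a'_eq0 scale0r add0r scaleNr.
    have -> : det3 y x v = a' * det3 y w v by rewrite xE /det3 !mxE; ring.
    by rewrite mulr_gt0// lt_neqAle eq_sym a'N0.
  - left; have wxE : det3 w x v = a * det3 y x v by rewrite wE /det3 !mxE; ring.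
    have aN0 : a != 0.
      by apply: contraTneq wx => a_eq0; rewrite wxE a_eq0 mul0r ltxx.
    by move: wx; rewrite wxE pmulr_rgt0// lt_neqAle eq_sym aN0.
  - right; exists (a' * a), (a' * b + b'); rewrite addr_ge0 ?mulr_ge0//.
    by split=> //; rewrite xE wE; apply: rowP3; rewrite !mxE; ring.
have [Xw wN0] := sX w sw.
have wminX : {in X, forall x, precedes v w x}.
  move=> x Xx; have [->|xN0] := eqVneq x 0; last first.
    by apply: wmin; rewrite mem_filter xN0.
  by right; exists 0, 0; rewrite !scale0r subr0 !lexx.
exists w; split=> //; apply/negPn; rewrite -all_predC; apply/negP => /allP noX.
have inplane x : x \in X -> exists a b, x = a *: w - b *: v.
  move=> Xx; have [x_gt0|[a [b [_ _ ->]]]] := wminX x Xx; last by exists a, b.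
  by have := noX x Xx; rewrite /= x_gt0.
have [a [b xE]] := inplane x0 Xx0; have [a' [b' yE]] := inplane y0 Xy0.
by move/eqP: d0; apply; rewrite xE yE /det3 !mxE; ring.
Qed.

(** * Adding an arbitrary vector *)

Lemma reach_add_spanning X v : all integral X -> integral v ->
    pointed (cone (v :: X)) -> ~ cone X v ->
    (exists x y, [/\ x \in X, y \in X & det3 x y v != 0]) ->
  reach (cone X) (cone (v :: X)).
Proof.
move=> iX iv pD nXv X3; have [w [Xw hasX wX]] := horizon pD nXv X3.
apply: (reach_from_horizon iX _ iv _ hasX wX); last exact: cone_gen.
exact: (allP iX).
Qed.

(** If [X] and [v] lie in the plane of [u] and [v], and [e] does not, then
    [cone X] and [cone (v :: X)] are faces of the cones obtained by adding [e],
    and the chain between the latter restricts to these faces. *)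
Lemma reach_add_from_prism X v u e :
    all integral X -> integral v -> integral e ->
    pointed (cone (v :: X)) -> ~ cone X v ->
    0 < det3 u e v -> {in X, forall x, det3 u x v = 0} ->
    (all integral (e :: X) -> pointed (cone (v :: e :: X)) ->
     ~ cone (e :: X) v -> reach (cone (e :: X)) (cone (v :: e :: X))) ->
  reach (cone X) (cone (v :: X)).
Proof.
move=> iX iv ie pD nXv e_gt0 uX add_e.
have l_lin := det3_linm u v; set l := fun y => det3 u y v in l_lin.
have lv : l v = 0 by rewrite /l det3xyy.
have le : l e != 0 by rewrite /l gt_eqF.
have l_ge0 : {in v :: e :: X, forall x, 0 <= l x}.
  move=> x; rewrite !inE => /or3P[/eqP->|/eqP->|/uX]; first by rewrite lv.
    exact: ltW.
  by rewrite /l => ->.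
have Xface : [seq x <- X | l x == 0] = X.
  by apply/all_filterP/allP => x /uX/eqP.
have eXface : cone (e :: X) `&` [set z | l z = 0] = cone X.
  rewrite (cone_face l_lin) => [|x Xx]; last first.
    by apply: l_ge0; rewrite inE Xx orbT.
  by rewrite /= (negPf le) Xface.
have veXface : cone (v :: e :: X) `&` [set z | l z = 0] = cone (v :: X).
  by rewrite (cone_face l_lin)//= lv eqxx (negPf le) Xface.
have D_ge0 := cone_halfspace l_lin l_ge0.
rewrite -eXface -veXface; apply: (reach_face l_lin) => //.
  by apply: rational_coneI; rewrite /= ie.
apply: add_e => [|[x [xN0 Dx DNx]]|Xv]; first by rewrite /= ie.
  apply: pD; exists x; rewrite -veXface; split=> //; split=> //=.
    apply: le_anti; rewrite D_ge0// andbT -oppr_ge0.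
    by have := D_ge0 _ DNx; rewrite /l -scaleN1r /det3 !mxE; lra.
  apply: le_anti; rewrite D_ge0// andbT -oppr_ge0.
  by have := D_ge0 _ Dx; rewrite /l -scaleN1r /det3 !mxE; lra.
by apply: nXv; rewrite -eXface.
Qed.

Lemma reach_add_nonparallel X v x : all integral X -> integral v ->
    pointed (cone (v :: X)) -> ~ cone X v -> x \in X -> cross x v <> 0 ->
  reach (cone X) (cone (v :: X)).
Proof.
move=> iX iv pD nXv Xx xv; have ix : integral x by exact: (allP iX).
have [hX|/hasPn noX] := boolP (has (fun y => det3 x y v != 0) X).
  have [y Xy xyv] := hasP hX.
  by apply: reach_add_spanning => //; exists x, y.
have [//|e_gt0] := cross_eq0_or_det3_gt0 x v.
apply: (reach_add_from_prism iX iv (cross_int iv ix) pD nXv e_gt0).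
  by move=> y /noX; rewrite negbK => /eqP.
move=> ieX peD neXv; apply: reach_add_spanning => //.
by exists x, (cross v x); rewrite !inE eqxx Xx orbT gt_eqF.
Qed.

Lemma reach_add X v : all integral X -> integral v -> pointed (cone (v :: X)) ->
  reach (cone X) (cone (v :: X)).
Proof.
move=> iX iv pD; have [Xv|nXv] := pselect (cone X v).
  by rewrite cone_cons_id//; exact: reach_refl.
have [hX|/hasPn noX] := boolP (has (fun x => cross x v != 0) X).
  have [x Xx /eqP xv] := hasP hX.
  exact: (reach_add_nonparallel iX iv pD nXv Xx xv).
have vN0 : v != 0.
  by apply/eqP => v0; apply: nXv; rewrite v0; exact: cone0.
have [u [iu uv]] : exists u, integral u /\ cross u v <> 0.
  have idelta j : integral (delta_mx 0 j : 'rV[R]_3).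
    by apply/integralP => i; rewrite mxE; case: andP.
  have [v00|/eqP v0N0] := eqVneq (v 0 0) 0.
    exists (delta_mx 0 0); split=> // c0; move/eqP: vN0; apply; apply: rowP3.
    - by rewrite v00 mxE.
    - have := congr1 (fun z => z 0 2%:R) c0.
      by rewrite crossE !mxE/= mul1r mul0r subr0.
    - have := congr1 (fun z => z 0 1) c0.
      rewrite crossE !mxE/= mul1r mul0r sub0r => /eqP.
      by rewrite oppr_eq0 => /eqP.
  exists (delta_mx 0 1); split=> // c0; apply: v0N0.
  have := congr1 (fun z => z 0 2%:R) c0.
  by rewrite crossE !mxE/= mul1r mul0r sub0r => /eqP; rewrite oppr_eq0 => /eqP.
have [//|e_gt0] := cross_eq0_or_det3_gt0 u v.
have ie := cross_int iv iu.
apply: (reach_add_from_prism iX iv ie pD nXv e_gt0).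
  move=> x /noX; rewrite negbK => /eqP/(parallel vN0)[t ->].
  by rewrite /det3 !mxE; ring.
move=> ieX peD neXv.
apply: (reach_add_nonparallel ieX iv peD neXv (mem_head _ _)) => ev0.
have [t eE] := parallel vN0 ev0.
by move: e_gt0; rewrite eE /det3 !mxE => /lt0r_neq0/eqP; apply; ring.
Qed.

Lemma reach_cat X Y : all integral X -> all integral Y ->
  pointed (cone (Y ++ X)) -> reach (cone X) (cone (Y ++ X)).
Proof.
move=> iX; elim: Y => [_ _|y Y IH iyY pYX]; first exact: reach_refl.
have /andP[iy iY] : integral y && all integral Y := iyY.
apply: reach_trans (IH iY _) _.
  by apply: pointed_sub pYX; exact: cone_consl.
by apply: reach_add => //; rewrite all_cat iY.
Qed.

End Visible.

Theorem theorem3p2 (R : realType) (C D : set 'rV[R]_3)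
  (hC : Cones C) (hD : Cones D) :
  cone_lt C D <-> C `<` D.
Proof.
split=> [|[CD nDC]]; first exact: cone_lt_proper.
apply: cone_lt_reach => //; last by move=> eqCD; apply: nDC; rewrite eqCD.
move: hC hD CD {nDC} => /ConesP[[X iX ->] _] /ConesP[[Y iY ->] pY] XY.
have YE : cone Y = cone (Y ++ X).
  apply: cone_eq => y; first by move=> Yy; apply: cone_gen; rewrite mem_cat Yy.
  by rewrite mem_cat => /orP[/cone_gen//|/cone_gen/XY].
by rewrite YE in pY *; exact: reach_cat.
Qed.
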